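(* Let $n\ge 1$. The graph $nK_2$ is $n$-super graceful if and only if $n=1$; likewise $nK_2$ is $n$-sequentially additive if and only if $n=1$.
   Context: $nK_2$ denotes the disjoint union of $n$ copies of $K_2$. For integers $a\le b$, $[a,b]$ is the set of integers between $a$ and $b$ inclusive. For a graph $G=(V,E)$ with $p$ vertices and $q$ edges and $k\ge1$: a $k$-super graceful labeling is a bijection $f:V\cup E\to[k,k+p+q-1]$ with $f(uv)=|f(u)-f(v)|$ for every edge $uv$; a $k$-sequentially additive labeling is a bijection $f:V\cup E\to[k,k+p+q-1]$ with $f(uv)=f(u)+f(v)$ for every edge $uv$. $G$ is $k$-super graceful (resp. $k$-sequentially additive) if it admits such a labeling. *)

(* Defs.v *)
From mathcomp Require Import all_boot all_order all_algebra.

Set Implicit Arguments.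
Unset Strict Implicit.
Unset Printing Implicit Defensive.

Record sgraph := SGraph {
  vertex :> finType;
  adj : rel vertex;
  adj_sym : symmetric adj;
  adj_irrefl : irreflexive adj
}.

Definition edges (G : sgraph) : {set {set G}} :=
  [set e | [exists u : G, exists v : G, adj u v && (e == [set u; v])]].

Definition edge (G : sgraph) : finType := {e : {set G} | e \in edges G}.

Section Complete.
Variable m : nat.

Definition complete_adj : rel 'I_m := fun i j => i != j.

Lemma complete_adj_sym : symmetric complete_adj.
Proof. by move=> i j; rewrite /complete_adj eq_sym. Qed.

Lemma complete_adj_irrefl : irreflexive complete_adj.
Proof. by move=> i; rewrite /complete_adj eqxx. Qed.

Definition complete_graph : sgraph :=
  SGraph complete_adj_sym complete_adj_irrefl.
End Complete.

Section Copies.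
Variables (n : nat) (G : sgraph).

Definition copies_adj : rel ('I_n * G) :=
  fun x y => (x.1 == y.1) && adj x.2 y.2.

Lemma copies_adj_sym : symmetric copies_adj.
Proof. by move=> x y; rewrite /copies_adj eq_sym adj_sym. Qed.

Lemma copies_adj_irrefl : irreflexive copies_adj.
Proof. by move=> x; rewrite /copies_adj adj_irrefl andbF. Qed.

Definition copies : sgraph := SGraph copies_adj_sym copies_adj_irrefl.
End Copies.

Definition nK2 (n : nat) : sgraph := copies n (complete_graph 2).

Definition bij_onto_interval (T : Type) (f : T -> nat) (a b : nat) : Prop :=
  injective f /\ (forall m : nat, (exists x, f x = m) <-> a <= m <= b).

(* The bound uses truncated subtraction, which is harmless for k >= 1. *)
Definition total_labeling (G : sgraph) (k : nat) (f : G + edge G -> nat) : Prop :=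
  bij_onto_interval f k (k + #|G| + #|edges G| - 1).

(* In the two definitions below, val e = [set u; v] says that e is the edge
   uv; since e is in edges G, this forces u and v to be adjacent. The subtraction in `|_ - _|%N is the one of
   int, not the truncated one. *)
Definition super_graceful_labeling (G : sgraph) (k : nat)
    (f : G + edge G -> nat) : Prop :=
  total_labeling k f /\
  (forall (u v : G) (e : edge G), val e = [set u; v] ->
     f (inr e) = `|f (inl u) - f (inl v)|%N).

Definition sequentially_additive_labeling (G : sgraph) (k : nat)
    (f : G + edge G -> nat) : Prop :=
  total_labeling k f /\
  (forall (u v : G) (e : edge G), val e = [set u; v] ->
     f (inr e) = f (inl u) + f (inl v)).

Definition super_graceful (k : nat) (G : sgraph) : Prop :=
  exists f : G + edge G -> nat, super_graceful_labeling k f.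

Definition sequentially_additive (k : nat) (G : sgraph) : Prop :=
  exists f : G + edge G -> nat, sequentially_additive_labeling k f.

(* Main.v *)
Require Import Defs.
From mathcomp Require Import all_boot all_order all_algebra.
From mathcomp Require Import zify.

(** In either kind of labeling, each copy of K_2 carries three labels one of
    which is the sum of the other two, so the labels of a copy add up to twice
    their maximum M.  The maxima are n distinct numbers at most 4n - 1, so
    their sum is at most 3n + ... + (4n - 1), whereas twice it is the sum of
    all of [n, 4n - 1].  Comparing gives n <= 1.  The bound on the sum of the
    maxima is obtained from M <= 3n + (M - 3n), where the sum of the truncated
    differences x - 3n is taken over all labels x. *)

Definition k2_edge_set (n : nat) (i : 'I_n) : {set nK2 n} :=
  [set (i, ord0); (i, ord_max)].

Lemma k2_edge_set_in (n : nat) (i : 'I_n) : k2_edge_set n i \in edges (nK2 n).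
Proof.
rewrite inE; apply/existsP; exists (i, ord0); apply/existsP; exists (i, ord_max).
by rewrite eqxx andbT /= /copies_adj eqxx.
Qed.

Definition k2_edge (n : nat) (i : 'I_n) : edge (nK2 n) :=
  exist _ (k2_edge_set n i) (k2_edge_set_in n i).

Lemma ord2P (j : 'I_2) : j = ord0 \/ j = ord_max.
Proof. by case: j => [[|[|//]] h]; [left | right]; apply: val_inj. Qed.

(** Indexing the edges by the copies gives their number and lets a sum over edges be reindexed over
    ['I_n]. *)
Lemma k2_edge_bij (n : nat) : bijective (@k2_edge n).
Proof.
have inj : injective (@k2_edge n).
  move=> i j /(congr1 val) /= E.
  have : (i, ord0) \in k2_edge_set n j by rewrite -E set21.
  by case/set2P => [] [].
have sur (e : edge (nK2 n)) : exists i, k2_edge n i == e.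
  case: e => e he; have := he; rewrite inE.
  case/existsP=> [[i u]] /existsP [[j v]] /andP[/andP[/= /eqP <- huv] /eqP E].
  exists i; apply/eqP/val_inj => /=; rewrite E /k2_edge_set.
  (* Adjacency leaves only the two orders of the endpoints [ord0] and [ord_max], which give the same
     set. *)
  by case: (ord2P u) (ord2P v) huv => -> [] -> //= _; rewrite setUC.
exists (fun e => xchoose (sur e)) => [i|e].
  by apply: inj; apply/eqP/(xchooseP (sur _)).
by apply/eqP/(xchooseP (sur _)).
Qed.

Lemma card_edge (G : sgraph) : #|{: edge G}| = #|edges G|.
Proof. by rewrite card_sig. Qed.

Lemma card_edges_nK2 (n : nat) : #|edges (nK2 n)| = n.
Proof. by rewrite -card_edge -(bij_eq_card (@k2_edge_bij n)) card_ord. Qed.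

Lemma card_nK2 (n : nat) : #|nK2 n| = n * 2.
Proof. by rewrite card_prod !card_ord. Qed.

(** The values of [f] are a permutation of [iota a m]. Positivity of [m] keeps the truncated bound
    [a + m - 1] correct even for [a = 0]. *)
Lemma sum_bij_onto_interval (T : finType) (f : T -> nat) (a m : nat)
    (F : nat -> nat) :
  0 < m -> bij_onto_interval f a (a + m - 1) ->
  \sum_t F (f t) = \sum_(x <- iota a m) F x.
Proof.
move=> m0 [inj rng]; rewrite -(big_map f xpredT F); apply: perm_big.
apply: uniq_perm; rewrite ?iota_uniq //.
  by rewrite map_inj_uniq // /index_enum -enumT enum_uniq.
move=> x; rewrite mem_iota; apply/mapP/idP => [[t _ ->]|hx].
  by have /rng : exists t', f t' = f t by [exists t]; lia.
have /rng [t <-] : a <= x <= a + m - 1 by lia.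
by exists t; rewrite ?mem_index_enum.
Qed.

Lemma sum_over_nK2 (n : nat) (F : nK2 n + edge (nK2 n) -> nat) :
  \sum_t F t = \sum_(i < n)
    (F (inl (i, ord0)) + F (inl (i, ord_max)) + F (inr (k2_edge n i))).
Proof.
rewrite big_sumType /= [X in _ + X](reindex _ (onW_bij _ (@k2_edge_bij n))) /=.
rewrite big_split /=; congr (_ + _).
under [RHS]eq_bigr => i _.
  rewrite (_ : _ + _ = \sum_(j < 2) F (inl (i, j))); last first.
    by rewrite big_ord_recr big_ord1 /=; congr (F (inl (_, _)) + _); apply: val_inj.
  over.
by rewrite pair_big /=; apply: eq_bigr => -[].
Qed.

(** Gauss's formula, with the division by 2 and the subtraction of [m] cleared. *)
Lemma sum_iota (a m : nat) :
  2 * (\sum_(x <- iota a m) x) + m = m * (2 * a + m).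
Proof.
elim: m a => [|m IH] a; first by rewrite big_nil.
by rewrite /= big_cons; have := IH a.+1; nia.
Qed.

Lemma sum_iota_truncated (n : nat) :
  2 * (\sum_(x <- iota n (3 * n)) (x - 3 * n)) + n = n * n.
Proof.
(* Split at [3 * n]: the lower part contributes zeros, the upper part 0, ..., n - 1. *)
have -> : iota n (3 * n) = iota n (2 * n) ++ [seq 3 * n + x | x <- iota 0 n].
  rewrite -iotaDl (_ : 3 * n + 0 = n + 2 * n); last by lia.
  by rewrite -iotaD; congr (iota _ _); lia.
rewrite big_cat big_map big_seq big1 => [|x]; last by rewrite mem_iota; lia.
rewrite /= add0n; under eq_bigr => x _ do rewrite addKn.
by rewrite sum_iota muln0.
Qed.

(** The only property of a copy's labels that the counting uses; it is common to both kinds of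
    labeling. *)
Definition sum_triple (a b c : nat) : Prop :=
  [\/ a + b = c, a + c = b | b + c = a].

(** The left side is twice the largest entry M, and M <= m + (M - m); the other two truncated
    differences can only enlarge the right side. *)
Lemma sum_triple_bound (a b c m : nat) :
  sum_triple a b c -> a + b + c <= 2 * (m + (a - m + (b - m) + (c - m))).
Proof. by case=> <-; lia. Qed.

Lemma sum_triple_dist (a b : nat) : sum_triple a b `|a - b|%N.
Proof. by case: (leqP a b) => h; [apply: Or32 | apply: Or33]; lia. Qed.

Lemma total_labeling_sum_triples (n : nat) (f : nK2 n + edge (nK2 n) -> nat) :
  0 < n -> total_labeling n f ->
  (forall i : 'I_n, sum_triple (f (inl (i, ord0))) (f (inl (i, ord_max)))
                               (f (inr (k2_edge n i)))) ->
  n = 1.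
Proof.
move=> n0; rewrite /total_labeling card_nK2 card_edges_nK2 => tot tri.
have {}tot : bij_onto_interval f n (n + 3 * n - 1).
  by move: tot; congr (bij_onto_interval f n (_ - 1)); lia.
have m0 : 0 < 3 * n by lia.
have S1 := sum_bij_onto_interval _ _ _ _ id m0 tot.
have S2 := sum_bij_onto_interval _ _ _ _ (fun x => x - 3 * n) m0 tot.
have : \sum_t f t <= 2 * (3 * n * n + \sum_t (f t - 3 * n)).
  rewrite !sum_over_nK2.
  rewrite (_ : 3 * n * n = \sum_(i < n) 3 * n); last first.
    by rewrite sum_nat_const card_ord mulnC.
  rewrite -big_split big_distrr /=; apply: leq_sum => i _.
  exact: sum_triple_bound.
(* With S the sum of the labels and T that of the truncated differences, 2S = 15n^2 - 3n and 2T =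
   n^2 - n, so S <= 2(3n^2 + T) reduces to n^2 <= n. *)
rewrite S1 S2 /=; have := sum_iota n (3 * n); have := sum_iota_truncated n.
by nia.
Qed.

(** An edge is an unordered pair, so the labeling condition must be checked for both orders of its
    endpoints. *)
Lemma k2_edge_eq (n : nat) (i : 'I_n) (u v : nK2 n) :
  val (k2_edge n i) = [set u; v] ->
  u = (i, ord0) /\ v = (i, ord_max) \/ u = (i, ord_max) /\ v = (i, ord0).
Proof.
move=> /= E.
have: (i, ord0) \in [set u; v] by rewrite -E set21.
have: (i, ord_max) \in [set u; v] by rewrite -E set22.
by case/set2P=> <- /set2P [] => [[]|<-|<-|[]] //; [right | left].
Qed.

Definition k2_labeling (a b c : nat) (t : nK2 1 + edge (nK2 1)) : nat :=
  match t with
  | inl x => if x.2 == ord0 then a else b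
  | inr _ => c
  end.

Lemma total_k2_labeling (a b c : nat) :
  perm_eq [:: a; b; c] [:: 1; 2; 3] -> total_labeling 1 (k2_labeling a b c).
Proof.
move=> P; have U := perm_uniq P; have M := perm_mem P.
rewrite /total_labeling card_nK2 card_edges_nK2; split.
  move: U; rewrite /= !inE negb_or andbT => /andP[/andP[ab ac] bc].
  have [g gK Kg] := k2_edge_bij 1.
  (* A single copy has a single edge, so two edges cannot violate injectivity. *)
  have uE (e e' : edge (nK2 1)) : e = e'.
    by rewrite -(Kg e) -(Kg e') (ord1 (g e)) (ord1 (g e')).
  move=> [[i u]|e] [[j v]|e'] /=; rewrite ?(ord1 i) ?(ord1 j).
  - by case: (ord2P u) (ord2P v) => -> [] -> //= E; rewrite E eqxx in ab.
  - by case: (ord2P u) => -> /= E; rewrite E eqxx in ac bc.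
  - by case: (ord2P v) => -> /= E; rewrite E eqxx in ac bc.
  - by rewrite (uE e e').
move=> m; have {M}Mm : (1 <= m <= 3) = (m \in [:: a; b; c]).
  by rewrite M !inE; lia.
rewrite (_ : 1 + _ + _ - 1 = 3) // Mm !inE; split.
  by case=> -[[i u]|e] /= <-; [case: ifP|]; rewrite eqxx ?orbT.
case/or3P=> /eqP ->.
- by exists (inl (ord0, ord0)).
- by exists (inl (ord0, ord_max)).
- by exists (inr (k2_edge 1 ord0)).
Qed.

Theorem theorem3p6 (n : nat) (hn : 1 <= n) :
  (super_graceful n (nK2 n) <-> n = 1) /\
  (sequentially_additive n (nK2 n) <-> n = 1).
Proof.
split; split.
- case=> f [tot lab]; apply: (total_labeling_sum_triples n f hn tot) => i.
  by rewrite (lab _ _ (k2_edge n i) erefl); apply: sum_triple_dist.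
(* The edge gets 2 = |1 - 3|. *)
- move=> ->; exists (k2_labeling 1 3 2); split; first exact: total_k2_labeling.
  have [g _ Kg] := k2_edge_bij 1.
  by move=> u v e; rewrite -(Kg e) => /k2_edge_eq [] [-> ->].
- case=> f [tot lab]; apply: (total_labeling_sum_triples n f hn tot) => i.
  by rewrite (lab _ _ (k2_edge n i) erefl); apply: Or31.
(* The edge gets 3 = 1 + 2. *)
- move=> ->; exists (k2_labeling 1 2 3); split; first exact: total_k2_labeling.
  have [g _ Kg] := k2_edge_bij 1.
  by move=> u v e; rewrite -(Kg e) => /k2_edge_eq [] [-> ->].
Qed.
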